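(* Let $d\ge 2$, let $F_d$ be the free group on $d$ generators, and let $\lambda$ be the symmetric uniform probability measure on the free generators and their inverses (each of these $2d$ elements has mass $\frac{1}{2d}$). Then $$I_\lambda(F_d)=\frac{d-1}{d}\ln(2d-1).$$
   Context: For probability measures $m,\nu$ in the same measure class on a measurable space $X$, $D_{KL}(m\|\nu):=\int_X -\ln\left(\frac{d\nu}{dm}\right)dm\in[0,\infty]$. A group $G$ acts on itself by left translation, and for a probability measure $\eta$ on $G$, $g\eta$ is the push-forward, i.e. $(g\eta)(x)=\eta(g^{-1}x)$. For a fully supported probability measure $\eta$ on $G$, $h_\lambda(G,\eta):=\sum_{g\in G}\lambda(g)D_{KL}(g\eta\|\eta)$, and $I_\lambda(G):=\inf_\eta h_\lambda(G,\eta)$, the infimum being over all fully supported probability measures $\eta$ on $G$. *)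

(* Defs.v *)
From HB Require Import structures.
From mathcomp Require Import all_boot all_order all_algebra.
From mathcomp Require Import all_classical all_reals all_analysis.

Set Implicit Arguments.
Unset Strict Implicit.
Unset Printing Implicit Defensive.

Import Order.TTheory GRing.Theory Num.Theory.

Local Open Scope classical_set_scope.
Local Open Scope ereal_scope.
Local Open Scope charge_scope.

Section relative_entropy.
Context d (T : measurableType d) (R : realType).

(* Meant for m and nu in the same measure class.  The negative part of the
   integrand is dominated by the density, so that the integral always makes
   sense in [0, +oo]. *)
Definition D_KL (m nu : probability T R) : \bar R :=
  \int[m]_x - lne (('d (charge_of_finite_measure nu) '/d m) x).

End relative_entropy.

Definition discrete (T : Type) : Type := T.

Section discrete_group.
Variable G : groupType.

HB.instance Definition _ := Group.copy (discrete G) G.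
HB.instance Definition _ := isPointed.Build (discrete G) (1%g : G).

HB.instance Definition _ := @isMeasurable.Build default_measure_display
  (discrete G) discrete_measurable discrete_measurable0
  discrete_measurableC discrete_measurableU.

Definition ltrans (g : G) (x : discrete G) : discrete G := (g * x)%g.

Let measurable_ltrans g : measurable_fun [set: discrete G] (ltrans g).
Proof. by []. Qed.

HB.instance Definition _ g :=
  isMeasurableFun.Build _ _ (discrete G) (discrete G) (ltrans g)
    (measurable_ltrans g).

Variable R : realType.
Implicit Types (lambda eta : probability (discrete G) R).

Definition translate (g : G) eta : probability (discrete G) R :=
  distribution eta (ltrans g).

Lemma translateE g eta (x : G) :
  translate g eta [set x] = eta [set (g^-1 * x)%g].
Proof.
rewrite /translate /distribution /pushforward; congr (eta _).
apply/seteqP; split=> y /=; rewrite /ltrans.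
  by move=> <-; rewrite mulKg.
by move=> ->; rewrite mulVKg.
Qed.

Definition fully_supported eta : Prop := forall x : G, 0 < eta [set x].

Definition h_entropy lambda eta : \bar R :=
  esum [set: G] (fun g => lambda [set g] * D_KL (translate g eta) eta).

Definition I_entropy lambda : \bar R :=
  ereal_inf [set h_entropy lambda eta | eta in fully_supported].

End discrete_group.

Section free_group.
Variable d : nat.

(* (i, true) stands for the i-th free generator, (i, false) for its inverse. *)
Definition letter : Type := ('I_d * bool)%type.
HB.instance Definition _ := Finite.on letter.

Implicit Types (a b : letter) (w u v : seq letter).

Definition letterV a : letter := (a.1, ~~ a.2).

Definition reduced w : bool := sorted (fun a b => b != letterV a) w.

Record free_group := FreeGroup { word : seq letter; _ : reduced word }.

HB.instance Definition _ := [isSub for word].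
HB.instance Definition _ := [Countable of free_group by <:].

Definition wcons a w : seq letter :=
  if w is b :: w' then if b == letterV a then w' else a :: w else [:: a].

Definition wmul u v : seq letter := foldr wcons v u.
Definition winv w : seq letter := rev (map letterV w).

Lemma letterVK : involutive letterV.
Proof. by case=> i b; rewrite /letterV /= negbK. Qed.

Lemma reduced_wcons a w : reduced w -> reduced (wcons a w).
Proof.
case: w => //= b w; rewrite /wcons; case: ifPn => [_ /path_sorted //|ba bw].
by rewrite /reduced /= ba.
Qed.

Lemma reduced_wmul u v : reduced v -> reduced (wmul u v).
Proof. by move=> rv; elim: u => //= a u; apply: reduced_wcons. Qed.

Lemma wcons_reduced a w : reduced (a :: w) -> wcons a w = a :: w.
Proof. by case: w => //= b w /andP[/negbTE ->]. Qed.

Lemma reduced_behead a w : reduced (a :: w) -> reduced w.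
Proof. exact: path_sorted. Qed.

Lemma wconsK a w : reduced w -> wcons (letterV a) (wcons a w) = w.
Proof.
case: w => [|b w] /= rw; first by rewrite letterVK eqxx.
case: eqP => [eb|_] /=; last by rewrite letterVK eqxx.
by rewrite -eb wcons_reduced.
Qed.

Lemma wmul_wcons a u v : reduced u -> reduced v ->
  wmul (wcons a u) v = wcons a (wmul u v).
Proof.
case: u => [//|b u] ru rv; rewrite {1}/wcons; case: eqP => [->|//] /=.
by have := wconsK (letterV a) (reduced_wmul u rv); rewrite letterVK => ->.
Qed.

Lemma wmulA u v w : reduced u -> reduced v -> reduced w ->
  wmul u (wmul v w) = wmul (wmul u v) w.
Proof.
move=> + rv rw; elim: u => //= a u IH ru.
rewrite IH ?(reduced_behead ru)// wmul_wcons//.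
exact: reduced_wmul.
Qed.

Lemma wmul1 w : reduced w -> wmul w [::] = w.
Proof.
elim: w => //= a w IH rw.
by rewrite IH ?(reduced_behead rw)// wcons_reduced.
Qed.

Lemma reduced_winv w : reduced w -> reduced (winv w).
Proof.
rewrite /reduced /winv rev_sorted sorted_map; apply: sub_sorted => a b.
by rewrite /= letterVK; apply: contra_neq => ->.
Qed.

Lemma winvK w : winv (winv w) = w.
Proof. by rewrite /winv map_rev revK mapK //; exact: letterVK. Qed.

Lemma wmulV w : reduced w -> wmul (winv w) w = [::].
Proof.
elim: w => //= a w IH rw; rewrite /winv /= rev_cons /wmul foldr_rcons /=.
by rewrite letterVK eqxx; apply: IH; exact: reduced_behead rw.
Qed.

Definition fg_one : free_group := @FreeGroup [::] isT.
Definition fg_mul (x y : free_group) : free_group :=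
  FreeGroup (reduced_wmul (word x) (valP y)).
Definition fg_inv (x : free_group) : free_group :=
  FreeGroup (reduced_winv (valP x)).

Lemma fg_mulA : associative fg_mul.
Proof. by move=> x y z; apply/val_inj/wmulA; exact: valP. Qed.

Lemma fg_mul1g : left_id fg_one fg_mul.
Proof. by move=> x; apply/val_inj. Qed.

Lemma fg_mulg1 : right_id fg_one fg_mul.
Proof. by move=> x; apply/val_inj/wmul1/valP. Qed.

Lemma fg_mulVg : left_inverse fg_one fg_inv fg_mul.
Proof. by move=> x; apply/val_inj/wmulV/valP. Qed.

Lemma fg_mulgV : right_inverse fg_one fg_inv fg_mul.
Proof.
move=> x; have {1}-> : x = fg_inv (fg_inv x) by apply/val_inj/esym/winvK.
exact: fg_mulVg.
Qed.

HB.instance Definition _ := isGroup.Build free_group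
  fg_mulA fg_mul1g fg_mulg1 fg_mulVg fg_mulgV.

Definition of_letter a : free_group := @FreeGroup [:: a] isT.

Definition generator (i : 'I_d) : free_group := of_letter (i, true).

Lemma of_letterE a :
  of_letter a = if a.2 then generator a.1 else (generator a.1)^-1%g.
Proof. by case: a => i []; apply/val_inj. Qed.

Lemma of_letter_inj : injective of_letter.
Proof. by move=> a b []. Qed.

(* The universal property of the free group. *)
Lemma free_group_univ (H : groupType) (f : 'I_d -> H) :
  exists! phi : free_group -> H,
    {morph phi : x y / (x * y)%g} /\ forall i, phi (generator i) = f i.
Proof.
pose val1 (a : letter) := if a.2 then f a.1 else (f a.1)^-1%g.
pose ev (w : seq letter) := foldr (fun a h => val1 a * h)%g 1%g w.
have val1V a : val1 (letterV a) = (val1 a)^-1%g.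
  by case: a => i []; rewrite /val1 //= invgK.
have ev_wcons a w : ev (wcons a w) = (val1 a * ev w)%g.
  case: w => //= b w; case: eqP => [->|//].
  by rewrite val1V mulVKg.
have ev_wmul u v : ev (wmul u v) = (ev u * ev v)%g.
  by elim: u => [|a u IH] /=; rewrite ?mul1g// ev_wcons IH mulgA.
exists (ev \o word); split.
  by split=> [x y|i]; [exact: ev_wmul|rewrite /= /val1 /= mulg1].
move=> phi [phiM phig]; apply/funext => -[w rw] /=.
have phi1 : phi 1%g = 1%g.
  by apply: (mulgI (phi 1%g)); rewrite -phiM !mulg1.
have phi_letter a : phi (of_letter a) = val1 a.
  rewrite of_letterE /val1; case: ifP => _; first exact: phig.
  by apply: (mulgI (f a.1)); rewrite -{1}phig -phiM !mulgV.
elim: w rw => [|a w IH] rw /=.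
  by rewrite -phi1; congr phi; exact: val_inj.
rewrite (IH (reduced_behead rw)) -phi_letter -phiM; congr phi.
by apply/val_inj; rewrite /= wcons_reduced.
Qed.

(* The masses of the 2 * d letters add up to 1, so this determines lambda. *)
Definition uniform_on_letters (R : realType)
    (lambda : probability (discrete free_group) R) : Prop :=
  forall a : letter, lambda [set of_letter a] = ((2 * d)%:R^-1)%R%:E.

End free_group.

(* Main.v *)
Require Import Defs.
From HB Require Import structures.
From mathcomp Require Import all_boot all_order all_algebra.
From mathcomp Require Import all_classical all_reals all_analysis.
From mathcomp Require Import ring lra.

Set Implicit Arguments.
Unset Strict Implicit.
Unset Printing Implicit Defensive.

Import Order.TTheory GRing.Theory Num.Theory.
Import numFieldNormedType.Exports.

(* Write |x| for the word length, q = 2d - 1, and C for the claimed value.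

   Lower bound. Since - ln u >= k + 1 - u e^k for all real k,
     D_KL(m || nu) >= int k dm + 1 - int e^k dnu        (k bounded).
   For m = a eta and nu = eta, with a a letter, take
   k(x) = (|x| - |a^-1 x|) ln q.  Averaging over the 2d letters gives
   h(eta) >= int Phi d eta, where Phi(x) is the average over a of
   (|a x| - |x|) ln q + 1 - q^(|x| - |a^-1 x|).  As exactly one letter shortens
   x <> 1, Phi(x) = (2d - 2) / (2d) ln q + 1 - (q + q q^-1) / (2d) = C, while
   Phi(1) >= C.

   Upper bound. For eta proportional to e^(- t |x|) with t > ln q, the
   logarithmic densities are exactly t (|a x| - |x|), so that
   h(eta) = t (d - 1 + eta(1)) / d, and eta(1) -> 0 as t -> ln q because the
   spheres have 2d q^(n-1) elements. *)

Local Open Scope ring_scope.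
Local Open Scope classical_set_scope.

(** * Relative entropy on a discrete group *)

Section discrete_probability.
Context (G : groupType) (R : realType).
Implicit Types (m nu P : probability (discrete G) R) (f k : discrete G -> R).
Local Open Scope charge_scope.

Lemma integrable_bounded P f M :
  (forall x, `|f x| <= M :> R) -> P.-integrable [set: discrete G] (EFin \o f).
Proof.
move=> fM; apply: measurable_bounded_integrable => //=.
  by apply: le_lt_trans (probability_le1 _ _) (ltry _).
by exists M; split; [exact: num_real|move=> y /ltW My x _; exact: le_trans My].
Qed.

(** Every point has positive mass, so only the empty set is [m]-null. *)
Lemma fully_supported_dominates m nu :
  fully_supported m -> charge_of_finite_measure nu `<< m.
Proof.
move=> m0; apply/null_content_dominatesP => A _ mA0 /=.
suff -> : A = set0 by rewrite measure0.
rewrite -subset0 => x Ax; have := m0 x; rewrite lt_neqAle => /andP[/negP + _].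
apply; apply/eqP/esym/le_anti; rewrite measure_ge0 andbT -[leRHS]mA0.
by apply: le_measure; rewrite ?inE// => y ->.
Qed.

(** Serves when the larger function is not integrable, as when [D_KL] is infinite; positive and
    negative parts are then compared separately. *)
Lemma le_integral_integrable P (f g : discrete G -> \bar R) :
  P.-integrable [set: discrete G] f -> (forall x, f x <= g x)%E ->
  (\int[P]_x f x <= \int[P]_x g x)%E.
Proof.
move=> intf fg.
have [intg|_] := pselect (P.-integrable [set: discrete G] g).
  by apply: le_integral => // x _; exact: fg.
rewrite integralE [leRHS]integralE leeB//; apply: ge0_le_integral => //= x _.
  by apply: (funepos_le (D := setT)) => [y _|]; rewrite ?inE//; exact: fg.
by apply: (funeneg_le (D := setT)) => [y _|]; rewrite ?inE//; exact: fg.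
Qed.

(** This is [1 + y <= expR y] at [y = ln r + k]; for [r <= 0] the right-hand side is [+oo]. *)
Lemma le_opp_lne (r k : R) : ((k + 1 - r * expR k)%:E <= - lne r%:E)%E.
Proof.
have [r0|r0] := leP r 0; first by rewrite le0_lneNy ?lee_fin//= leey.
have := expR_ge1Dx (ln r + k); rewrite expRD lnK// => le_exp.
by rewrite lne_EFin// -EFinN lee_fin; lra.
Qed.

(** Integrates [le_opp_lne] with [r] the density of [nu]; the change of variables absorbs that
    density, turning [m] into [nu] in the exponential term. *)
Lemma D_KL_ge m nu k M : charge_of_finite_measure nu `<< m ->
  (forall x, `|k x| <= M :> R) ->
  (\int[m]_x (k x + 1)%:E - \int[nu]_x (expR (k x))%:E <= D_KL m nu)%E.
Proof.
move=> num kM.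
have ik : m.-integrable [set: discrete G] (EFin \o (k \+ cst 1)).
  apply: (@integrable_bounded _ _ (M + 1)) => x /=.
  by rewrite (le_trans (ler_normD _ _))// normr1 lerD2r.
have ek x : `|expR (k x)| <= expR M.
  by rewrite ger0_norm ?expR_ge0// ler_expR (le_trans (ler_norm _)).
have ie := integrable_bounded nu ek.
rewrite -(@Radon_Nikodym_change_of_variables _ _ _ nu m)//.
rewrite /D_KL; set u := 'd _ '/d _.
have iu : m.-integrable setT (fun x => (expR (k x))%:E * u x)%E.
  apply: integrableMr => //; last exact: Radon_Nikodym_integrable.
  exists (expR M); split; first exact: num_real.
  by move=> y /ltW My x _; exact: le_trans My.
have /= <- := integralB measurableT ik iu.
apply: le_integral_integrable; first exact: integrableB.
move=> x /=; rewrite -(@fineK _ (u x)) ?Radon_Nikodym_fin_num//.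
by rewrite -EFinM -EFinB [expR _ * _]mulrC le_opp_lne.
Qed.

Lemma D_KL_ge0 m nu : fully_supported m -> (0 <= D_KL m nu)%E.
Proof.
move=> m0.
have int1 P : (\int[P]_x 1%:E = 1)%E.
  by rewrite integral_cst// mul1e; exact: probability_setT.
have := @D_KL_ge m nu (cst 0) 0 (fully_supported_dominates nu m0).
rewrite /= expR0 add0r !int1 subee// => /(_ (fun=> _)).
by apply; rewrite normr0.
Qed.

Lemma Radon_Nikodym_atom m nu x : charge_of_finite_measure nu `<< m ->
  ('d (charge_of_finite_measure nu) '/d m x * m [set x] = nu [set x])%E.
Proof.
move=> num; have := Radon_Nikodym_integral num (I : measurable [set x]).
move=> /= ->; rewrite -integral_cst//; apply: eq_integral => y.
by rewrite inE => ->.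
Qed.

(** Since each atom of [m] has positive mass, the density is determined at every point and equals
    [expR (- f x)]. *)
Lemma D_KL_eq m nu f : fully_supported m ->
  (forall x, nu [set x] = (expR (- f x))%:E * m [set x])%E ->
  D_KL m nu = (\int[m]_x (f x)%:E)%E.
Proof.
move=> m0 nuE; apply: eq_integral => x _.
have num := fully_supported_dominates nu m0.
have := Radon_Nikodym_atom x num; rewrite nuE.
have ufin := Radon_Nikodym_fin_num x num.
have mfin : m [set x] \is a fin_num by exact: fin_num_measure.
rewrite -(fineK ufin) -(fineK mfin) -!EFinM => -[/mulIf ->].
  by rewrite lne_EFin ?expR_gt0// expRK -EFinN opprK.
by rewrite gt_eqF// -lte_fin fineK.
Qed.

Lemma integral_translate g P f M : (forall x, `|f x| <= M :> R) ->
  (\int[translate g P]_x (f x)%:E = \int[P]_x (f (g * x)%g)%:E)%E.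
Proof.
move=> fM; rewrite integral_distribution//.
by apply: (@integrable_bounded P (f \o ltrans g) M) => x; exact: fM.
Qed.

Lemma fully_supported_translate g P :
  fully_supported P -> fully_supported (translate g P).
Proof. by move=> P0 x; rewrite translateE. Qed.

End discrete_probability.

Lemma fsbig_finType (T : finType) (R : Type) (idx : R)
    (op : Monoid.com_law idx) (F : T -> R) :
  \big[op/idx]_(x \in [set: T]) F x = \big[op/idx]_x F x.
Proof.
rewrite [RHS]fsbig_seq ?index_enum_uniq//; apply: eq_fsbigl.
by apply/seteqP; split=> x //= _; rewrite mem_index_enum.
Qed.

(** * Word length under left multiplication by a letter *)

Section letters.
Variable d : nat.
Implicit Types (a b : letter d) (w : seq (letter d)) (x y : free_group d).

Definition wlen x : nat := size (word x).

Lemma card_letter : #|{: letter d}| = (2 * d)%N.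
Proof. by rewrite card_prod card_ord card_bool mulnC. Qed.

Lemma of_letterV a : (of_letter a)^-1%g = of_letter (letterV a).
Proof. exact/val_inj. Qed.

Lemma sum_of_letterV (V : nmodType) (F : free_group d -> V) :
  \sum_(a : letter d) F (of_letter a)^-1%g =
  \sum_(a : letter d) F (of_letter a).
Proof.
rewrite [RHS](reindex_inj (inv_inj (@letterVK d))).
by apply: eq_bigr => a _; rewrite of_letterV.
Qed.

Lemma wlen_eq0 x : (wlen x == 0%N) = (x == 1%g).
Proof. by rewrite /wlen size_eq0. Qed.

(* Exactly one letter shortens a nontrivial reduced word. *)
Lemma sum_wlen (V : nmodType) (h : nat -> V) x :
  \sum_(a : letter d) h (wlen (of_letter a * x)%g) =
  if x == 1%g then h 1%N *+ (2 * d)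
  else h (wlen x).-1 + h (wlen x).+1 *+ (2 * d).-1.
Proof.
rewrite -wlen_eq0 /wlen /=; case: (word x) => [|b w] /=.
  by rewrite sumr_const card_letter.
rewrite (bigD1 (letterV b))//= letterVK eqxx; congr (_ + _).
rewrite (eq_bigr (fun=> h (size w).+2)) => [|a /negbTE ab].
  by rewrite sumr_const -card_letter -(cardC1 (letterV b)).
case: eqP => // b_aV; move: ab.
by rewrite b_aV letterVK eqxx.
Qed.

Lemma dist_wlen (R : realDomainType) a x :
  `|(wlen (of_letter a * x)%g)%:R - (wlen x)%:R| = 1 :> R.
Proof.
rewrite /wlen /=; case: (word x) => [|b w] /=; first by rewrite subr0 normr1.
case: ifP => _ /=.
  by rewrite distrC -natrB//= subSnn normr1.
by rewrite -natrB//= subSnn normr1.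
Qed.

End letters.

(** * Reduction of the entropy to a finite sum over letters *)

Section uniform_on_letters.
Context (R : realType) (d : nat) (d_gt0 : (0 < d)%N).
Variables lambda : probability (discrete (free_group d)) R.
Hypothesis lambdaE : uniform_on_letters lambda.
Local Open Scope ereal_scope.

(** The letters already exhaust the total mass [1], so their complement is null. *)
Lemma uniform_on_letters_notin (g : free_group d) :
  ~ range (@of_letter d) g -> lambda [set g] = 0.
Proof.
move=> g_letter; apply/le_anti/andP; split; last exact: measure_ge0.
have -> : 0 = lambda (~` range (@of_letter d)).
  rewrite probability_setC// -[X in lambda X]bigcup_imset1 measure_fin_bigcup//.
  - rewrite fsbig_finType (eq_bigr _ (fun a _ => lambdaE a)) sumEFin sumr_const.
    rewrite card_letter -[(_ *+ _)%R]mulr_natr mulVf ?subee//.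
    by rewrite pnatr_eq0 muln_eq0 -lt0n d_gt0.
  - exact: finite_finset.
  - by move=> a b _ _ [_ [-> /of_letter_inj]].
by apply: le_measure; rewrite ?inE// => _ ->.
Qed.

Lemma h_entropyE (eta : probability (discrete (free_group d)) R) :
  fully_supported eta ->
  h_entropy lambda eta = \sum_(a : letter d)
    ((2 * d)%:R^-1)%:E * D_KL (translate (of_letter a) eta) eta.
Proof.
move=> eta0; rewrite /h_entropy.
rewrite (_ : esum _ _ = \esum_(g in range (@of_letter d))
    lambda [set g] * D_KL (translate g eta) eta); last first.
  rewrite [RHS]esum_mkcond; apply: eq_esum => g _; case: ifPn => //.
  by rewrite notin_setE => gN; rewrite uniform_on_letters_notin ?mul0e.
rewrite (esum_image setT (@of_letter d)); last by move=> a b _ _ /of_letter_inj.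
rewrite esum_fset ?fsbig_finType; last 2 first.
- exact: finite_finset.
- move=> a _; rewrite mule_ge0// D_KL_ge0//.
  exact: fully_supported_translate.
by apply: eq_bigr => a _; rewrite lambdaE.
Qed.

End uniform_on_letters.

(** * Lower bound for every measure; exact value for geometric weights *)

Section entropy_of_free_group.
Context (R : realType) (d : nat) (d_gt0 : (0 < d)%N).
Implicit Types (a : letter d) (x y : free_group d).
Implicit Types (eta lambda : probability (discrete (free_group d)) R).

Let q : R := 2 * d%:R - 1.

Let dR_ge1 : 1 <= d%:R :> R. Proof. by rewrite ler1n. Qed.

Let q_ge1 : 1 <= q. Proof. by have := dR_ge1; rewrite /q; lra. Qed.

Let natr_2d : (2 * d)%:R = q + 1 :> R.
Proof. by rewrite natrM /q subrK. Qed.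

Let natr_2dP : (2 * d).-1%:R = q :> R.
Proof. by rewrite -subn1 natrB ?muln_gt0// natr_2d addrK. Qed.

Let dwlen a x : R := (wlen (of_letter a * x)%g)%:R - (wlen x)%:R.

(** Away from [1%g] one letter shortens and [2d - 1] lengthen; at [1%g] all [2d] lengthen. *)
Let sum_dwlen x :
  \sum_a dwlen a x = 2 * d%:R - 2 + 2 * (x == 1%g)%:R.
Proof.
rewrite (sum_wlen (fun n => n%:R - (wlen x)%:R)) -wlen_eq0.
case: (wlen x) => [|n] /=.
  by rewrite -[_ *+ (2 * d)]mulr_natr natr_2d /q; ring.
rewrite -[_ *+ (2 * d).-1]mulr_natr natr_2dP /q.
by rewrite -[n.+2%:R]natr1 -natr1; ring.
Qed.

Let dwlenV a x :
  (wlen x)%:R - (wlen ((of_letter a)^-1 * x)%g)%:R = - dwlen (letterV a) x.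
Proof. by rewrite /dwlen of_letterV opprB. Qed.

Let norm_dwlen a x : `|dwlen a x| = 1.
Proof. exact: dist_wlen. Qed.

(* The test function is the logarithmic Radon-Nikodym cocycle of the weight
   [q ^- wlen x]; this weight is superharmonic, hence the sum of exponentials
   is at most [2 * d]. *)
Let sum_test_ge x :
  (2 * d%:R - 2) * ln q <=
  \sum_a (dwlen a x * ln q + 1 - expR (- dwlen (letterV a) x * ln q)).
Proof.
have q_gt0 : 0 < q by exact: lt_le_trans q_ge1.
have lnq_ge0 : 0 <= ln q by rewrite ln_ge0.
rewrite sumrB big_split/= -mulr_suml sum_dwlen sumr_const card_letter.
rewrite -(reindex_inj (P := xpredT) (F := fun a => expR (- dwlen a x * ln q))
  (inv_inj (@letterVK d)))/=.
rewrite natr_2d.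
rewrite (sum_wlen (fun n => expR (- (n%:R - (wlen x)%:R) * ln q))) -wlen_eq0.
(* For nontrivial [x] the [q] lengthening letters contribute [q * q^-1 = 1]. *)
have eq1 : expR (- 1 * ln q) * q = 1.
  by rewrite mulN1r expRN lnK ?mulVf ?gt_eqF// posrE.
case: (wlen x) => [|n] /=.
  rewrite -[_ *+ (2 * d)]mulr_natr natr_2d.
  rewrite mulr1n subr0 mulr1 [_ * (q + 1)]mulrDr eq1 mulN1r expRN lnK ?posrE//.
  (* At the identity the exponentials add up to [1 + q^-1 <= q + 1]. *)
  have : q^-1 <= 1 by rewrite invf_le1.
  by have := q_ge1; lra.
rewrite -[_ *+ (2 * d).-1]mulr_natr natr_2dP mulr0n.
have -> : - (n%:R - n.+1%:R) = 1 :> R by rewrite -natr1; ring.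
have -> : n.+2%:R - n.+1%:R = 1 :> R by rewrite -[n.+2%:R]natr1; ring.
(* The shortening letter adds [q], so the exponentials sum to [q + 1 = 2d] and cancel the ones
   exactly. *)
by rewrite eq1 mul1r lnK ?posrE//; lra.
Qed.

(** The integral against the translate in [D_KL_ge] is pulled back along left multiplication by [a],
    which turns [k] into [dwlen a x * ln q]; both terms are then integrals against [eta]. *)
Lemma D_KL_translate_ge eta a : fully_supported eta ->
  (\int[eta]_x (dwlen a x * ln q + 1 - expR (- dwlen (letterV a) x * ln q))%:E
    <= D_KL (translate (of_letter a) eta) eta)%E.
Proof.
move=> eta0; have eta0' := fully_supported_translate (of_letter a) eta0.
pose k x := - dwlen (letterV a) x * ln q.
have kq x : `|k x| <= ln q.
  by rewrite normrM normrN norm_dwlen mul1r ger0_norm// ln_ge0.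
apply: le_trans (D_KL_ge (fully_supported_dominates eta eta0') kq).
have k1q x : `|k x + 1| <= ln q + 1.
  by rewrite (le_trans (ler_normD _ _))// normr1 lerD2r.
rewrite (integral_translate _ _ k1q).
have kE x : k (of_letter a * x)%g = dwlen a x * ln q.
  by rewrite /k -dwlenV mulKg.
have i1 : eta.-integrable [set: discrete (free_group d)]
    (EFin \o (fun x => k (of_letter a * x)%g + 1)).
  by apply: (@integrable_bounded _ _ _ _ (ln q + 1)) => x; exact: k1q.
have i2 : eta.-integrable [set: discrete (free_group d)]
    (EFin \o (fun x => expR (k x))).
  apply: (@integrable_bounded _ _ _ _ q) => x.
  rewrite ger0_norm ?expR_ge0// -[leRHS]lnK ?posrE ?(lt_le_trans _ q_ge1)//.
  by rewrite ler_expR (le_trans (ler_norm _)).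
have /= <- := integralB measurableT i1 i2.
by under [leRHS]eq_integral do rewrite kE -EFinB.
Qed.

Lemma h_entropy_ge lambda eta :
  uniform_on_letters lambda -> fully_supported eta ->
  (((d%:R - 1) / d%:R * ln q)%:E <= h_entropy lambda eta)%E.
Proof.
move=> lambdaE eta0; rewrite h_entropyE//.
pose F a x : R :=
  dwlen a x * ln q + 1 - expR (- dwlen (letterV a) x * ln q).
have iF a : eta.-integrable [set: discrete (free_group d)] (EFin \o F a).
  apply: (@integrable_bounded _ _ _ _ (ln q + 1 + q)) => x.
  rewrite /F (le_trans (ler_normB _ _))// lerD//.
    rewrite (le_trans (ler_normD _ _))// normr1 lerD2r.
    by rewrite normrM norm_dwlen mul1r ger0_norm// ln_ge0.
  rewrite ger0_norm ?expR_ge0// -[leRHS]lnK ?posrE ?(lt_le_trans _ q_ge1)//.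
  rewrite ler_expR (le_trans (ler_norm _))// normrM normrN norm_dwlen mul1r.
  by rewrite ger0_norm// ln_ge0.
(* Extracts the mass of a letter, leaving the constant of [sum_test_ge]. *)
have -> : (d%:R - 1) / d%:R * ln q = (2 * d)%:R^-1 * ((2 * d%:R - 2) * ln q).
  rewrite natrM; field.
  by rewrite pnatr_eq0 -lt0n.
rewrite EFinM -ge0_sume_distrr => [|a _]; last first.
  exact: D_KL_ge0 (fully_supported_translate _ _).
rewrite lee_pmul2l// ?lte_fin ?invr_gt0 ?ltr0n ?muln_gt0//.
apply: (@le_trans _ _ (\sum_a \int[eta]_x (F a x)%:E)%E); last first.
  by apply: lee_sum => a _; exact: D_KL_translate_ge.
rewrite -integral_sum//.
have /= <- : (\int[eta]_x cst ((2 * d%:R - 2) * ln q)%:E x =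
    ((2 * d%:R - 2) * ln q)%:E)%E.
  by rewrite integral_cst// [X in (_ * X)%E]probability_setT mule1.
apply: le_integral => //.
- exact: finite_measure_integrable_cst.
- by apply: integrable_sum => // a _; exact: iF.
- by move=> x _; rewrite sumEFin lee_fin; exact: sum_test_ge.
Qed.

(** Here [c] is the mass of [1%g]; it enters because no letter shortens the identity. *)
Lemma h_entropy_geometric lambda eta (c t : R) :
  uniform_on_letters lambda -> 0 < c ->
  (forall x, eta [set x] = (c * expR (- (t * (wlen x)%:R)))%:E) ->
  h_entropy lambda eta = ((d%:R - 1 + c) / d%:R * t)%:E.
Proof.
move=> lambdaE c0 etaE.
have eta0 : fully_supported eta.
  by move=> x; rewrite etaE lte_fin mulr_gt0 ?expR_gt0.
have i1 a : eta.-integrable [set: discrete (free_group d)] (EFin \o dwlen a).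
  by apply: (@integrable_bounded _ _ _ _ 1) => x; rewrite norm_dwlen.
rewrite h_entropyE// (eq_bigr (fun a => ((2 * d)%:R^-1 * t)%:E *
    \int[eta]_x (dwlen a x)%:E)%E) => [|a _]; last first.
  rewrite EFinM -muleA; congr (_ * _)%E.
  have := integralZl measurableT (i1 a) t.
  move=> /= <-.
  (* The constant [c] cancels in the ratio of the two masses at [x], leaving the exponent
     [- t (|x| - |a^-1 x|)]. *)
  rewrite (@D_KL_eq _ _ _ _ (fun x => t * - dwlen (letterV a) x)).
  - rewrite (@integral_translate _ _ _ _ _ `|t|) => [|x].
      by apply: eq_integral => x _; rewrite -dwlenV mulKg.
    by rewrite normrM normrN norm_dwlen mulr1.
  - exact: fully_supported_translate.
  - move=> x; rewrite translateE !etaE -EFinM; congr (_%:E).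
    rewrite mulrCA -expRD -dwlenV; congr (_ * expR _).
    by ring.
have iE : (\sum_a \int[eta]_x (dwlen a x)%:E = (2 * d%:R - 2 + 2 * c)%:E)%E.
  rewrite -integral_sum//.
  rewrite (eq_integral (fun x : discrete (free_group d) => (2 * d%:R - 2)%:E +
      2%:E * (\1_[set (1%g : discrete (free_group d))] x)%:E)%E); last first.
    move=> x _; rewrite sumEFin sum_dwlen indicE -EFinM -EFinD.
    by congr (_ + _ * _%:R)%:E; rewrite classical_sets.in_set1.
  have i2 : eta.-integrable [set: discrete (free_group d)]
      (EFin \o \1_[set (1%g : discrete (free_group d))]).
    apply: (@integrable_bounded _ _ _ _ 1) => x.
    by rewrite indicE; case: (_ \in _); rewrite ?normr1 ?normr0.
  rewrite integralD//; last 2 first.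
  - exact: finite_measure_integrable_cst.
  - exact: integrableZl.
  rewrite integralZl// integral_indic// setIT [X in (2%:E * X)%E]etaE /=.
  rewrite integral_cst// [X in (_ * X)%E]probability_setT mule1.
  by rewrite mulr0 oppr0 expR0 mulr1.
have d0 : d%:R != 0 :> R by rewrite pnatr_eq0 -lt0n.
rewrite -fin_num_sume_distrr//.
  rewrite iE -EFinM; congr (_%:E).
  by rewrite natrM; field.
move=> a b _ _; apply: fin_num_adde_defl.
by apply: integrable_fin_num => //; exact: i1.
Qed.

End entropy_of_free_group.

(** * Enumeration of the spheres of the free group *)

Section spheres.
Variable d : nat.
Implicit Types (a : letter d) (x y : free_group d).

(** Words grow on the left, and the filter discards cancellations; [count_sphere] shows that nothing
    is missed or repeated. *)
Fixpoint sphere n : seq (free_group d) :=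
  if n is m.+1 then
    [seq x <- [seq (of_letter a * y)%g | y <- sphere m, a <- enum {: letter d}]
        | wlen x == m.+1]
  else [:: 1%g].

Lemma big_sphere (V : nmodType) (F : free_group d -> V) n :
  \sum_(x <- sphere n.+1) F x =
  \sum_(y <- sphere n) \sum_a
    (if wlen (of_letter a * y)%g == n.+1 then F (of_letter a * y)%g else 0).
Proof.
rewrite big_filter big_mkcond big_allpairs_dep.
by apply: eq_bigr => y _; rewrite big_enum.
Qed.

Lemma wlen_sphere n x : x \in sphere n -> wlen x = n.
Proof. case: n => [|n] /=; first by rewrite inE => /eqP->.
by rewrite mem_filter => /andP[/eqP]. Qed.

(** A word of length [n + 1] has exactly one predecessor of length [n], obtained by deleting its
    first letter. *)
Lemma count_sphere n x : (\sum_(y <- sphere n) (y == x) = (wlen x == n))%N.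
Proof.
elim: n x => [|n IH] x; first by rewrite big_seq1 wlen_eq0 eq_sym.
rewrite big_sphere exchange_big/=.
(* The product of [a] and [y] is [x] only for [y = a^-1 x], so the induction hypothesis leaves a
   count of letters. *)
transitivity (if wlen x == n.+1 then
    \sum_a (wlen ((of_letter a)^-1 * x)%g == n : nat) else 0)%N; last first.
  case: eqP => // xn.
  rewrite (sum_of_letterV (fun g => (wlen (g * x)%g == n : nat))).
  rewrite (sum_wlen (fun k => k == n : nat)) -wlen_eq0 xn /= eqxx.
  by rewrite gtn_eqF ?mul0rn ?addr0.
case: ifP => xn.
  apply: eq_bigr => a _; rewrite -IH; apply: eq_bigr => y _.
  have -> : (y == (of_letter a)^-1 * x)%g = (of_letter a * y == x)%g.
    by rewrite -(inj_eq (mulgI (of_letter a))) mulVKg.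
  by case: (eqVneq _ x) => [->|_]; rewrite ?xn ?if_same.
rewrite big1// => a _; rewrite big1// => y _.
by case: ifP => // yn; case: (eqVneq _ x) => // yx; rewrite -yx yn in xn.
Qed.

(** All [2d] letters lead outwards from [1%g], and all but one from any other point. *)
Lemma size_sphereS n : size (sphere n.+1) = (2 * d * (2 * d).-1 ^ n)%N.
Proof.
have step m : size (sphere m.+1) =
    (size (sphere m) * if m is 0 then 2 * d else (2 * d).-1)%N.
  rewrite -[LHS]sum1_size big_sphere big_seq.
  rewrite (eq_bigr (fun=> if m is 0 then 2 * d else (2 * d).-1)%N).
    by rewrite -big_seq big_const_seq count_predT iter_addn_0 mulnC.
  move=> y /wlen_sphere ym.
  rewrite (sum_wlen (fun k => if k == m.+1 then 1 else 0)%N) -wlen_eq0 ym.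
  case: m ym => [|m] _ /=; first exact: natn.
  by rewrite eqxx ltn_eqF ?add0r ?natn// ltnW.
elim: n => [|n IH]; first by rewrite step mul1n muln1.
by rewrite step IH -mulnA -expnSr.
Qed.

End spheres.

(** * The probability measure proportional to [exp(- t |x|)] *)

Section geometric_measure.
Context (R : realType) (d : nat) (t : R).
Hypothesis d_gt0 : (0 < d)%N.

Let q : R := 2 * d%:R - 1.
Let s : R := expR (- t).
Hypothesis qs1 : q * s < 1.

Let weight n : {nonneg R} := NngNum (expR_ge0 (- (t * n%:R))).

(** Built from Dirac masses by measure operations, so that the measure structure is inherited; the
    default [1%g] of [nth] is never reached. *)
Definition geometric_measure : set (discrete (free_group d)) -> \bar R :=
  mseries (fun n => mscale (weight n)
    (msum (fun k => dirac (nth 1%g (sphere d n) k : discrete (free_group d)))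
      (size (sphere d n)))) 0.

HB.instance Definition _ := Measure.on geometric_measure.

Lemma geometric_measureE A : geometric_measure A =
  (\sum_(0 <= n <oo) (expR (- (t * n%:R)))%:E *
     \sum_(y <- sphere d n) \d_(y : discrete (free_group d)) A)%E.
Proof.
apply: eq_eseriesr => n _; rewrite /mscale/= /msum; congr (_ * _)%E.
by rewrite (big_nth 1%g) big_mkord.
Qed.

Lemma geometric_measure1 x :
  geometric_measure [set x] = (expR (- (t * (wlen x)%:R)))%:E.
Proof.
have massE n : (\sum_(y <- sphere d n) \d_(y : discrete (free_group d)) [set x]
    = (wlen x == n)%:R%:E :> \bar R)%E.
  rewrite -count_sphere natr_sum -sumEFin; apply: eq_bigr => y _.
  by rewrite diracE classical_sets.in_set1.
rewrite geometric_measureE.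
under eq_eseriesr do rewrite massE.
rewrite (nneseriesD1 (n := wlen x))//.
rewrite eqxx mule1 eseries0 ?adde0// => k _ /andP[_].
by rewrite eq_sym => /negbTE ->; rewrite mule0.
Qed.

(** Summing over spheres gives [1 + 2d s / (1 - q s)], where [2d = q + 1]. *)
Lemma geometric_measureT :
  geometric_measure [set: discrete (free_group d)] =
  ((1 + s) / (1 - q * s))%:E.
Proof.
have massE n : (\sum_(y <- sphere d n)
    \d_(y : discrete (free_group d)) [set: discrete (free_group d)]
    = (size (sphere d n))%:R%:E :> \bar R)%E.
  rewrite -sum1_size natr_sum -sumEFin; apply: eq_bigr => y _.
  by rewrite diracT.
rewrite geometric_measureE.
under eq_eseriesr do rewrite massE -EFinM.
(* Radius [0] is split off, since the sphere size is geometric only from radius [1] on. *)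
rewrite nneseries_recl//.
rewrite mulr0 oppr0 expR0 mul1r -(@nneseries_addn _ _ 1); last first.
  by move=> k; rewrite lee_fin mulr_ge0 ?expR_ge0.
have termE n : expR (- (t * (n + 1)%:R)) * (size (sphere d (n + 1)))%:R =
    geometric (2 * d%:R * s) (q * s) n.
  rewrite addn1 size_sphereS natrM natrX /= exprMn.
  have -> : (2 * d).-1%:R = q.
    by rewrite -subn1 natrB ?muln_gt0// natrM.
  have -> : expR (- (t * n.+1%:R)) = s * s ^+ n.
    by rewrite /s -expRM_natr -expRD -natr1; congr expR; ring.
  by rewrite natrM; ring.
under eq_eseriesr do rewrite termE.
have qs_lt1 : `|q * s| < 1.
  rewrite ger0_norm ?mulr_ge0 ?expR_ge0// /q.
  have : 1 <= d%:R :> R by rewrite ler1n.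
  by lra.
have cvg_geo := @cvg_geometric_series R (2 * d%:R * s) (q * s) qs_lt1.
have -> : (\sum_(0 <= n <oo) (geometric (2 * d%:R * s) (q * s) n)%:E =
    (2 * d%:R * s * (1 - q * s)^-1)%:E)%E.
  rewrite -(cvg_lim _ cvg_geo)// -EFin_lim; last exact/cvgP/cvg_geo.
  by congr (limn _); apply/funext => n /=; rewrite sumEFin.
rewrite -EFinD; congr (_%:E) => /=.
have -> : 2 * d%:R = q + 1 by rewrite /q subrK.
field.
by rewrite subr_eq0 eq_sym lt_eqF.
Qed.

Lemma geometric_probability :
  exists eta : probability (discrete (free_group d)) R, forall x,
    eta [set x] =
    ((1 - q * s) / (1 + s) * expR (- (t * (wlen x)%:R)))%:E.
Proof.
pose mu : {measure set (discrete (free_group d)) -> \bar R} :=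
  geometric_measure.
have muT : mu [set: discrete (free_group d)] = _ := geometric_measureT.
have mu1 x : mu [set x] = _ := geometric_measure1 x.
(* The Dirac mass is the fallback for total mass [0] or [+oo], excluded below. *)
exists (mnormalize mu (dirac (1%g : discrete (free_group d)))) => x.
rewrite /= /mnormalize muT.
rewrite ifF; last first.
  rewrite orbF eqe gt_eqF// divr_gt0 ?subr_gt0//.
  by rewrite addr_gt0 ?expR_gt0.
by rewrite /= mu1 invf_div -EFinM mulrC.
Qed.

End geometric_measure.

(** * The two bounds meet as [t] decreases to [ln q] *)

Theorem theoremB (R : realType) (d : nat) (hd : (2 <= d)%N)
    (lambda : probability (discrete (free_group d)) R)
    (hlambda : uniform_on_letters lambda) :
  I_entropy lambda = ((d%:R - 1) / d%:R * ln (2 * d%:R - 1))%:E.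
Proof.
have d_gt0 : (0 < d)%N by exact: ltnW.
have d1 : 1 <= d%:R :> R by rewrite ler1n.
set q : R := 2 * d%:R - 1.
have q_gt0 : 0 < q by rewrite /q; lra.
apply/le_anti/andP; split; last first.
  by apply: le_ereal_inf_tmp => _ [eta eta0 <-]; exact: h_entropy_ge.
(* Obtained from the exact entropy by replacing [c] with its upper bound [1 - q * expR (- t)]; it is
   continuous and takes the claimed value at [ln q]. *)
pose G t : R := (d%:R - q * expR (- t)) / d%:R * t.
have le_G t : ln q < t -> (I_entropy lambda <= (G t)%:E)%E.
  move=> qt.
  have qs1 : q * expR (- t) < 1.
    by rewrite -[q]lnK ?posrE// -expRD expR_lt1 subr_lt0.
  have s_gt0 := expR_gt0 (- t).
  have [eta etaE] := @geometric_probability R d t d_gt0 qs1.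
  set c : R := (1 - q * expR (- t)) / (1 + expR (- t)) in etaE.
  have c_gt0 : 0 < c by rewrite divr_gt0 ?subr_gt0// addr_gt0.
  apply: (@le_trans _ _ (h_entropy lambda eta)).
    apply: ereal_inf_lbound; exists eta => // x.
    by rewrite etaE lte_fin mulr_gt0 ?expR_gt0.
  rewrite (h_entropy_geometric d_gt0 hlambda c_gt0 etaE) lee_fin.
  have t_ge0 : 0 <= t by rewrite (le_trans _ (ltW qt))// ln_ge0// /q; lra.
  rewrite ler_wpM2r// ler_pM2r ?invr_gt0 ?ltr0n//.
  have : c <= 1 - q * expR (- t).
    by rewrite ler_pdivrMr ?addr_gt0// ler_peMr ?subr_ge0 ?lerDl // ltW.
  by lra.
have G_ln : G (ln q) = (d%:R - 1) / d%:R * ln q.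
  by rewrite /G expRN lnK ?posrE// mulfV ?gt_eqF.
(* The geometric weights are summable only for [t > ln q], hence a limit from the right. *)
have cG : G t @[t --> (ln q)^'+] --> G (ln q).
  apply: cvg_at_right_filter.
  apply: cvgM; last exact: cvg_id.
  apply: cvgMl; apply: cvgB; first exact: cvg_cst.
  apply: cvgMr; apply: continuous_comp; last exact: continuous_expR.
  exact: opp_continuous.
apply/lee_addgt0Pr => e e0; rewrite -G_ln -EFinD.
have /filter_ex[t [qt /ltW Gt]] : \forall t \near (ln q)^'+,
    ln q < t /\ G t < G (ln q) + e.
  near=> t; split; first by near: t; exact: nbhs_right_gt.
  near: t; apply: (cvgr_lt _ cG); by rewrite ltrDl.
by apply: le_trans (le_G t qt) _; rewrite lee_fin.
Unshelve. all: by end_near.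
Qed.
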